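(* Let $\mathbf{k}$ be an algebraically closed field of characteristic $0$, $A$ a finite-dimensional associative $\mathbf{k}$-algebra, $\phi$ a symmetric linear function on $A$, $\nu$ a central element of $A$, $r\in\mathbf{k}$ and $s\in\mathbb{Z}_{>0}$. Assume that $\phi((\nu-r)^sa)=0$ for all $a\in A$ and that $A=A_1\oplus A_2\oplus\cdots\oplus A_\ell$ is a decomposition of $A$ into two-sided ideals. Then there exist symmetric linear functions $\phi_i\in\mathrm{SLF}(A_i)$, basic algebras $P_i$ associated with $B_i=A/\mathrm{Rad}(\phi_i)$ which are symmetric algebras, and $(A,P_i)$-bimodules $M_i$ ($1\le i\le\ell$) satisfying $(\nu-r)^sM_i=0$, the left $A$-action on $M_i$ factoring through $B_i$, and $M_i$ being finitely generated projective both as a left $B_i$-module and as a right $P_i$-module, such that $$\phi(b)=\sum_{i=1}^{\ell}\bigl((\phi_i)_{{}_{B_i}M_i}\bigr)_{(M_i)_{P_i}}(b)\qquad\text{for all }b\in A,$$ where $b$ on the right-hand side is viewed as the right $P_i$-linear endomorphism of $M_i$ given by the left action of $b$.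
   Context: A linear function $\phi$ on an algebra $B$ is symmetric if $\phi(ab)=\phi(ba)$ for all $a,b\in B$; $\mathrm{SLF}(B)$ is the space of these. A symmetric linear function $\phi_i$ on $A_i$ is regarded as one on $A$ by extending it by zero on $A_j$, $j\neq i$. For $\phi\in\mathrm{SLF}(A)$, $\mathrm{Rad}(\phi)=\{a\in A\mid\phi(Aa)=0\}$, a two-sided ideal; $\phi$ induces a symmetric linear function on $A/\mathrm{Rad}(\phi)$, again denoted $\phi$. A symmetric algebra is a finite-dimensional algebra admitting a nondegenerate symmetric associative bilinear form. The zero algebra and zero modules are allowed (they occur when $\phi_i=0$). Basic algebra associated with an algebra $B$: let $1=\sum_{i=1}^n\sum_{j=1}^{n_i}e_{ij}$ be a decomposition of the unity of $B$ into mutually orthogonal primitive idempotents with $e_{ij}B\cong e_{ik}B$ for all $j,k$ and $e_{ij}B\not\cong e_{k\ell}B$ for $i\ne k$; put $e=\sum_{i=1}^ne_{i1}$. Then $eBe$, with unity $e$, is the basic algebra associated with $B$. For an algebra $B$, a finitely generated projective right $B$-module $V$ and $\psi\in\mathrm{SLF}(B)$, define $\psi_V\in\mathrm{SLF}(\mathrm{End}_B(V))$ by $\psi_V(\beta)=\psi(\sum_i\alpha_i(\beta(u_i)))$, where $u_i\in V$, $\alpha_i\in\mathrm{Hom}_B(V,B)$ are finitely many elements with $v=\sum_iu_i\alpha_i(v)$ for all $v\in V$ (independent of choices). For left modules the definition is the same with $v=\sum_i\alpha_i(v)u_i$. In the formula, $(\phi_i)_{{}_{B_i}M_i}$, a symmetric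 linear function on $\mathrm{End}_{B_i}(M_i)$, is regarded as a symmetric linear function on $P_i$ via the right action $P_i\to\mathrm{End}_{B_i}(M_i)$, $p\mapsto(m\mapsto mp)$ (an algebra anti-homomorphism), and then $((\phi_i)_{{}_{B_i}M_i})_{(M_i)_{P_i}}$ is the resulting symmetric linear function on $\mathrm{End}_{P_i}(M_i)$. *)

(* Defs.v *)
From HB Require Import structures.
From mathcomp Require Import all_boot all_order all_algebra.
From mathcomp Require Import boolp.

Set Implicit Arguments.
Unset Strict Implicit.
Unset Printing Implicit Defensive.

Import GRing.Theory.
Local Open Scope ring_scope.
Local Open Scope quotient_scope.

(* Associative unital k-algebras: rings B with a ring morphism from k to the
   centre of B. Unlike in [algType], 1 = 0 is allowed: the zero algebra does
   occur here, as A / Rad(0). *)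
HB.mixin Record PzRing_isPzAlgebra (k : pzRingType) B of GRing.PzRing B := {
  scal : {rmorphism k -> B};
  scalC : forall (c : k) (b : B), scal c * b = b * scal c
}.

#[short(type="pzAlgType")]
HB.structure Definition PzAlgebra (k : pzRingType) :=
  {B of PzRing_isPzAlgebra k B & GRing.PzRing B}.

(* The k-module underlying a k-algebra. *)
Section UnderlyingModule.
Variables (k : pzRingType) (B : pzAlgType k).

Definition kmod : Type := B.
HB.instance Definition _ := GRing.Zmodule.on kmod.

Definition kmod_scale (c : k) (b : kmod) : kmod := scal c * (b : B).
Fact kmod_scaleA c d b : kmod_scale c (kmod_scale d b) = kmod_scale (c * d) b.
Proof. by rewrite /kmod_scale rmorphM mulrA. Qed.
Fact kmod_scale1 : left_id 1 kmod_scale.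
Proof. by move=> b; rewrite /kmod_scale rmorph1 mul1r. Qed.
Fact kmod_scaleDr : right_distributive kmod_scale +%R.
Proof. by move=> c a b; apply: mulrDr. Qed.
Fact kmod_scaleDl b : {morph kmod_scale^~ b : c d / c + d}.
Proof. by move=> c d; rewrite /kmod_scale rmorphD; apply: mulrDl. Qed.
HB.instance Definition _ := GRing.Zmodule_isLmodule.Build k kmod
  kmod_scaleA kmod_scale1 kmod_scaleDr kmod_scaleDl.
End UnderlyingModule.

Definition finite_dimensional (k : fieldType) (B : pzAlgType k) : Prop :=
  exists (n : nat) (f : {linear kmod B -> 'rV[k]_n}), bijective f.

HB.mixin Record isTwoSided (B : pzRingType) (I : B -> bool) := {
  ideal_mull : forall a x : B, I x -> I (a * x);
  ideal_mulr : forall a x : B, I x -> I (x * a)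
}.

#[short(type="idealType")]
HB.structure Definition TwoSidedIdeal (B : pzRingType) :=
  {I of GRing.ZmodClosed B I & isTwoSided B I}.

Definition direct_sum (B : pzRingType) (l : nat) (I : 'I_l -> {pred B}) : Prop :=
  forall a : B, exists! x : {ffun 'I_l -> B},
    (forall i, x i \in I i) /\ a = \sum_i x i.

Section QuotientAlgebra.
Variables (k : pzRingType) (B : pzAlgType k) (I : idealType B).

Definition algquot : Type := Quotient.quot I.
HB.instance Definition _ := GRing.Zmodule.on algquot.

Definition qproj (a : B) : algquot := \pi_(Quotient.quot I) a.
Definition qrepr (x : algquot) : B := repr (x : Quotient.quot I).

Lemma qreprK : cancel qrepr qproj.
Proof. by move=> x; rewrite /qproj /qrepr reprK. Qed.

Lemma qproj_eq a b : (qproj a == qproj b) = (a - b \in I).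
Proof. by rewrite Quotient.idealrBE. Qed.

Lemma qprojB : {morph qproj : a b / a - b}.
Proof. by move=> a b; rewrite /qproj -[RHS](raddfB (\pi_(Quotient.quot I))). Qed.

Lemma qprojD : {morph qproj : a b / a + b}.
Proof. by move=> a b; rewrite /qproj -[RHS](raddfD (\pi_(Quotient.quot I))). Qed.

Lemma qrepr_proj a : qrepr (qproj a) - a \in I.
Proof. by rewrite -qproj_eq qreprK. Qed.

Definition qmul (x y : algquot) : algquot := qproj (qrepr x * qrepr y).

Lemma qprojM a b : qproj (a * b) = qmul (qproj a) (qproj b).
Proof.
apply/esym/eqP; rewrite qproj_eq.
have -> : qrepr (qproj a) * qrepr (qproj b) - a * b =
  (qrepr (qproj a) - a) * qrepr (qproj b) + a * (qrepr (qproj b) - b).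
  by rewrite mulrBl mulrBr addrA subrK.
by rewrite rpredD //; [apply: ideal_mulr|apply: ideal_mull]; apply: qrepr_proj.
Qed.

Fact qmulA : associative qmul.
Proof.
move=> x y z; rewrite -[x]qreprK -[y]qreprK -[z]qreprK.
by rewrite -!qprojM mulrA.
Qed.
Fact qmul1 : left_id (qproj 1) qmul.
Proof. by move=> x; rewrite -[x]qreprK -!qprojM mul1r. Qed.
Fact qmulr1 : right_id (qproj 1) qmul.
Proof. by move=> x; rewrite -[x]qreprK -!qprojM mulr1. Qed.
Fact qmulDl : left_distributive qmul +%R.
Proof.
move=> x y z; rewrite -[x]qreprK -[y]qreprK -[z]qreprK.
by rewrite -!(qprojM, qprojD) mulrDl.
Qed.
Fact qmulDr : right_distributive qmul +%R.
Proof.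
move=> x y z; rewrite -[x]qreprK -[y]qreprK -[z]qreprK.
by rewrite -!(qprojM, qprojD) mulrDr.
Qed.
HB.instance Definition _ := GRing.Zmodule_isPzRing.Build algquot
  qmulA qmul1 qmulr1 qmulDl qmulDr.

Definition qscal (c : k) : algquot := qproj (scal c).
Fact qscal_zmod_morphism : zmod_morphism qscal.
Proof. by move=> c d; rewrite /qscal rmorphB qprojB. Qed.
Fact qscal_monoid_morphism : monoid_morphism qscal.
Proof. by split=> [|c d]; rewrite /qscal ?rmorph1 // rmorphM qprojM. Qed.
HB.instance Definition _ := GRing.isZmodMorphism.Build k algquot qscal
  qscal_zmod_morphism.
HB.instance Definition _ := GRing.isMonoidMorphism.Build k algquot qscal
  qscal_monoid_morphism.

Fact qscalC (c : k) (x : algquot) : qscal c * x = x * qscal c.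
Proof. by rewrite -[x]qreprK -[LHS]qprojM -[RHS]qprojM scalC. Qed.
HB.instance Definition _ := PzRing_isPzAlgebra.Build k algquot qscalC.
End QuotientAlgebra.

Record idem (B : pzRingType) := Idem {
  idem_val :> B;
  idemP : idem_val * idem_val = idem_val
}.

Section Corner.
Variables (k : pzRingType) (B : pzAlgType k) (eB : idem B).
Local Notation e := (idem_val eB).

Definition in_corner : {pred B} := fun x => e * x * e == x.

Fact corner_zmod_closed : zmod_closed in_corner.
Proof.
split=> [|x y]; first by rewrite unfold_in mulr0 mul0r.
rewrite !unfold_in => /eqP xe /eqP ye.
by rewrite mulrBr mulrBl xe ye.
Qed.
HB.instance Definition _ := GRing.isZmodClosed.Build B in_corner
  corner_zmod_closed.

(* The algebra eBe, with unity e. *)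
Record corner := Corner { corner_val :> B; _ : corner_val \in in_corner }.
HB.instance Definition _ := [isSub for corner_val].
HB.instance Definition _ := [Choice of corner by <:].
HB.instance Definition _ := [SubChoice_isSubZmodule of corner by <:].

Lemma corner_valP (x : corner) : e * val x * e = val x.
Proof. by case: x => x /= /eqP. Qed.
Lemma corner_ell (x : corner) : e * val x = val x.
Proof. by rewrite -corner_valP !mulrA idemP. Qed.
Lemma corner_elr (x : corner) : val x * e = val x.
Proof. by rewrite -corner_valP -!mulrA idemP. Qed.

Fact corner_mul_subproof (x y : corner) : val x * val y \in in_corner.
Proof. by rewrite unfold_in mulrA corner_ell -mulrA corner_elr. Qed.
Fact corner_one_subproof : e \in in_corner.
Proof. by rewrite unfold_in !idemP. Qed.
Fact corner_scal_subproof (c : k) : scal c * e \in in_corner.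
Proof. by rewrite unfold_in mulrA -scalC -!mulrA !idemP. Qed.

Definition corner_mul x y : corner := Corner (corner_mul_subproof x y).
Definition corner_one : corner := Corner corner_one_subproof.
Definition corner_scal c : corner := Corner (corner_scal_subproof c).

Fact corner_mulA : associative corner_mul.
Proof. by move=> x y z; apply: val_inj; rewrite /= mulrA. Qed.
Fact corner_mul1 : left_id corner_one corner_mul.
Proof. by move=> x; apply: val_inj; apply: corner_ell. Qed.
Fact corner_mulr1 : right_id corner_one corner_mul.
Proof. by move=> x; apply: val_inj; apply: corner_elr. Qed.
Fact corner_mulDl : left_distributive corner_mul +%R.
Proof. by move=> x y z; apply: val_inj; rewrite /= mulrDl. Qed.
Fact corner_mulDr : right_distributive corner_mul +%R.
Proof. by move=> x y z; apply: val_inj; rewrite /= mulrDr. Qed.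
HB.instance Definition _ := GRing.Zmodule_isPzRing.Build corner
  corner_mulA corner_mul1 corner_mulr1 corner_mulDl corner_mulDr.

Fact corner_scal_zmod_morphism : zmod_morphism corner_scal.
Proof. by move=> c d; apply: val_inj; rewrite /= rmorphB mulrBl. Qed.
Fact corner_scal_monoid_morphism : monoid_morphism corner_scal.
Proof.
split=> [|c d]; apply: val_inj; rewrite /= ?rmorph1 ?mul1r // rmorphM.
have -> : scal c * e * (scal d * e) = scal c * (e * scal d * e).
  by rewrite !mulrA.
by rewrite -[e * scal d]scalC -[scal d * e * e]mulrA idemP mulrA.
Qed.
HB.instance Definition _ := GRing.isZmodMorphism.Build k corner corner_scal
  corner_scal_zmod_morphism.
HB.instance Definition _ := GRing.isMonoidMorphism.Build k corner corner_scal
  corner_scal_monoid_morphism.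

Fact corner_scalC (c : k) (x : corner) : corner_scal c * x = x * corner_scal c.
Proof.
apply: val_inj; change (scal c * e * val x = val x * (scal c * e)).
by rewrite -mulrA corner_ell mulrA -scalC -mulrA corner_elr.
Qed.
HB.instance Definition _ := PzRing_isPzAlgebra.Build k corner corner_scalC.
End Corner.

(* Right B-modules are left modules over the converse ring B^c. The right
   ideal eB of an idempotent e is {x | e x = x}. *)
Section RightIdeal.
Variables (B : pzRingType) (e : B).

Definition in_rideal : {pred (B^c)^o} := fun x => e * (x : B) == x.

Fact rideal_submod_closed : submod_closed in_rideal.
Proof.
split=> [|c x y]; first by rewrite unfold_in mulr0.
rewrite !unfold_in => /eqP ex /eqP ey.
apply/eqP; rewrite -[in RHS]ex -[in RHS]ey.
by rewrite [LHS]mulrDr [e * (c *: x)](mulrA e (x : B) (c : B)) ey ex.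
Qed.
HB.instance Definition _ := GRing.isSubmodClosed.Build B^c (B^c)^o in_rideal
  rideal_submod_closed.

Record rideal := RIdeal { rideal_val : (B^c)^o; _ : rideal_val \in in_rideal }.
HB.instance Definition _ := [isSub for rideal_val].
HB.instance Definition _ := [Choice of rideal by <:].
HB.instance Definition _ := [SubChoice_isSubLmodule of rideal by <:].
End RightIdeal.

Definition mod_iso (R : pzRingType) (U V : lmodType R) : Prop :=
  exists f : {linear U -> V}, bijective f.

Definition primitive_idempotent (B : pzRingType) (e : B) : Prop :=
  [/\ e != 0, e * e = e
    & forall f g : B, f * f = f -> g * g = g -> f * g = 0 -> g * f = 0 ->
        e = f + g -> f = 0 \/ g = 0].

(* The idempotents E (i, j) are indexed by pairs i < n, j < (m i).+1, so that
   n_i = (m i).+1 >= 1, and j = 0 plays the role of the first index. *)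
Definition basic_idempotent (B : pzRingType) (e : B) : Prop :=
  exists (n : nat) (m : 'I_n -> nat) (E : {i : 'I_n & 'I_(m i).+1} -> B),
    [/\ forall x, primitive_idempotent (E x),
        forall x y, x != y -> E x * E y = 0,
        \sum_x E x = 1,
        forall x y, mod_iso (rideal (E x)) (rideal (E y)) <-> tag x = tag y
      & e = \sum_(i < n) E (existT (fun i => 'I_(m i).+1) i ord0)].

Definition symmetric_algebra (k : fieldType) (B : pzAlgType k) : Prop :=
  finite_dimensional B /\
  exists f : {biscalar kmod B},
    [/\ forall a b : B, f a b = f b a,
        forall a b c : B, f (a * b) c = f a (b * c)
      & forall a : B, (forall b : B, f a b = 0) -> a = 0].

(* SLF(B). *)
Record slf (k : fieldType) (B : pzAlgType k) := Slf {
  slf_val :> {scalar kmod B};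
  slfC : forall a b : B, slf_val (a * b) = slf_val (b * a)
}.

(* phi, as a function on the direct sum of the ideals I j, is the extension by
   zero of its restriction to I i, a symmetric linear function on I i. *)
Definition extended_by_zero (k : fieldType) (B : pzAlgType k) (l : nat)
    (I : 'I_l -> idealType B) (i : 'I_l) (phi : slf B) : Prop :=
  forall j, j != i -> forall a : B, a \in I j -> phi a = 0.

Section Rad.
Variables (k : fieldType) (B : pzAlgType k) (phi : slf B).

Definition Rad : {pred B} := fun a => `[< forall b, phi (b * a) = 0 >].

Fact Rad_zmod_closed : zmod_closed Rad.
Proof.
split=> [|x y]; rewrite !unfold_in.
  by apply/asboolP => b; rewrite mulr0 linear0.
move=> /asboolP Rx /asboolP Ry; apply/asboolP => b.
by rewrite mulrBr linearB Rx Ry subr0.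
Qed.
HB.instance Definition _ := GRing.isZmodClosed.Build B Rad Rad_zmod_closed.

Fact Rad_mull (a x : B) : Rad x -> Rad (a * x).
Proof. by move=> /asboolP Rx; apply/asboolP => b; rewrite mulrA Rx. Qed.
Fact Rad_mulr (a x : B) : Rad x -> Rad (x * a).
Proof.
by move=> /asboolP Rx; apply/asboolP => b; rewrite mulrA slfC mulrA Rx.
Qed.
HB.instance Definition _ := isTwoSided.Build B Rad Rad_mull Rad_mulr.

(* The function induced by phi on B / Rad(phi); it does not depend on the
   representative, by slf_quotE. *)
Definition slf_quot (x : algquot Rad) : k := phi (qrepr x).

Lemma slf_quotE (a : B) : slf_quot (qproj Rad a) = phi a.
Proof.
apply/eqP; rewrite -subr_eq0 -linearB -[_ - _]mul1r.
by have /asboolP-> := qrepr_proj Rad a.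
Qed.
End Rad.

Section Modules.
Variables (R : pzRingType) (V : lmodType R).

Definition finitely_generated : Prop :=
  exists (n : nat) (u : 'I_n -> V),
    forall v, exists c : 'I_n -> R, v = \sum_i c i *: u i.

Definition projective : Prop :=
  forall (X Y : lmodType R) (f : {linear X -> Y}) (g : {linear V -> Y}),
    (forall y, exists x, f x = y) ->
    exists h : {linear V -> X}, forall v, f (h v) = g v.

Definition fg_projective : Prop := finitely_generated /\ projective.

Definition dual_basis (d : seq (V * {linear V -> R^o})) : Prop :=
  forall v, v = \sum_(p <- d) (p.2 v : R) *: p.1.

Definition a_dual_basis : seq (V * {linear V -> R^o}) :=
  if pselect (exists d, dual_basis d) is left ex then sval (cid ex) else [::].

(* psi_V. For a right B-module V take R = B^c: then a *: v reads v a, and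
   {linear V -> R^o} is Hom_B(V, B). *)
Definition slf_mod (T : Type) (psi : R -> T) (beta : {linear V -> V}) : T :=
  psi (\sum_(p <- a_dual_basis) (p.2 (beta p.1) : R)).
End Modules.

Record bimodule (k : fieldType) (A P : pzAlgType k) := Bimodule {
  bim_sort :> zmodType;
  lact : A -> bim_sort -> bim_sort;
  ract : bim_sort -> P -> bim_sort;
  lactA : forall a b m, lact a (lact b m) = lact (a * b) m;
  lact1 : forall m, lact 1 m = m;
  lactDr : forall a m n, lact a (m + n) = lact a m + lact a n;
  lactDl : forall a b m, lact (a + b) m = lact a m + lact b m;
  ractA : forall m p q, ract (ract m p) q = ract m (p * q);
  ract1 : forall m, ract m 1 = m;
  ractDl : forall m n p, ract (m + n) p = ract m p + ract n p;
  ractDr : forall m p q, ract m (p + q) = ract m p + ract m q;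
  lractA : forall a m p, lact a (ract m p) = ract (lact a m) p;
  lract_scalar : forall (c : k) m, lact (scal c) m = ract m (scal c)
}.

Section RightModule.
Variables (k : fieldType) (A P : pzAlgType k) (M : bimodule A P).

(* M as a right P-module. *)
Definition rmod : Type := M.
HB.instance Definition _ := GRing.Zmodule.on rmod.

Definition rmod_scale (p : P^c) (m : rmod) : rmod := ract m p.
Fact rmod_scaleA (p q : P^c) m :
  rmod_scale p (rmod_scale q m) = rmod_scale (p * q) m.
Proof. exact: ractA. Qed.
Fact rmod_scale1 : left_id 1 rmod_scale. Proof. exact: ract1. Qed.
Fact rmod_scaleDr : right_distributive rmod_scale +%R.
Proof. by move=> p m n; apply: ractDl. Qed.
Fact rmod_scaleDl m : {morph rmod_scale^~ m : p q / p + q}.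
Proof. by move=> p q; apply: ractDr. Qed.
HB.instance Definition _ := GRing.Zmodule_isLmodule.Build P^c rmod
  rmod_scaleA rmod_scale1 rmod_scaleDr rmod_scaleDl.

Definition left_mul (a : A) (m : rmod) : rmod := lact a m.
Fact left_mul_linear a : linear (left_mul a).
Proof.
by move=> p m n; rewrite /left_mul lactDr; congr (_ + _); apply: lractA.
Qed.
HB.instance Definition _ a := GRing.isLinear.Build P^c rmod rmod _
  (left_mul a) (left_mul_linear a).
End RightModule.

Section LeftQuotientModule.
Variables (k : fieldType) (A P : pzAlgType k) (I : idealType A).
Variable M : bimodule A P.

Definition factors_through : Prop :=
  forall (a : A) (m : M), a \in I -> lact a m = 0.

Hypothesis IM : factors_through.

(* M as a left A/I-module. The type mentions IM only so that the module
   instance below, which needs it, can be attached to it. *)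
Definition lqmod : Type := let _ := IM in M.
HB.instance Definition _ := GRing.Zmodule.on lqmod.

Definition lqmod_scale (x : algquot I) (m : lqmod) : lqmod := lact (qrepr x) m.

Lemma lqmod_scaleE (a : A) (m : lqmod) :
  lqmod_scale (qproj I a) m = lact a (m : M).
Proof.
rewrite /lqmod_scale -[qrepr _](subrK a) lactDl.
by rewrite IM ?add0r // qrepr_proj.
Qed.

Fact lqmod_scaleA x y m :
  lqmod_scale x (lqmod_scale y m) = lqmod_scale (x * y) m.
Proof.
by rewrite -[x]qreprK -[y]qreprK -[_ * _]qprojM !lqmod_scaleE lactA.
Qed.
Fact lqmod_scale1 : left_id 1 lqmod_scale.
Proof. by move=> m; rewrite (lqmod_scaleE 1) lact1. Qed.
Fact lqmod_scaleDr : right_distributive lqmod_scale +%R.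
Proof. by move=> x m n; apply: lactDr. Qed.
Fact lqmod_scaleDl m : {morph lqmod_scale^~ m : x y / x + y}.
Proof.
move=> x y; rewrite -[x]qreprK -[y]qreprK -qprojD !lqmod_scaleE.
exact: lactDl.
Qed.
HB.instance Definition _ := GRing.Zmodule_isLmodule.Build (algquot I) lqmod
  lqmod_scaleA lqmod_scale1 lqmod_scaleDr lqmod_scaleDl.

Definition right_mul (p : P) (m : lqmod) : lqmod := ract (m : M) p.
Fact right_mul_linear p : linear (right_mul p).
Proof.
move=> x m n; rewrite /right_mul ractDl; congr (_ + _).
exact/esym/lractA.
Qed.
HB.instance Definition _ p := GRing.isLinear.Build (algquot I) lqmod lqmod _
  (right_mul p) (right_mul_linear p).
End LeftQuotientModule.

Section PullBack.
Variables (k : fieldType) (A P : pzAlgType k) (phi : slf A).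
Variables (M : bimodule A P) (hM : factors_through (Rad phi) M).

(* With B = A / Rad(phi): slf_left is phi_{_B M}, pulled back to P along the
   right action of P, and slf_left_right is (phi_{_B M})_{M_P}, pulled back to
   A along the left action of A. *)
Definition slf_left (p : P) : k :=
  @slf_mod (algquot (Rad phi)) (lqmod hM) k (slf_quot (phi := phi))
    (right_mul (IM := hM) p).

Definition slf_left_right (b : A) : k :=
  @slf_mod P^c (rmod M) k slf_left (left_mul (M := M) b).
End PullBack.

(* Main.v *)
(* Write 1 = c_1 + ... + c_l with c_i in A_i; the c_i are central and
   phi_i(a) = phi(a c_i) cuts phi down to A_i. On B_i = A / Rad(phi_i) the
   function phi_i is nondegenerate, hence so is its restriction to e B_i e for
   an idempotent e. Take e basic and M_i = B_i e.
   The pair (e, inclusion) is a dual basis of B_i e over B_i, so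
   (phi_i)_{M_i} is the restriction of phi_i to e B_i e. As e is basic,
   B_i e B_i = B_i; writing 1 = sum_j x_j e y_j, the pairs (x_j e, e y_j -)
   form a dual basis of B_i e over e B_i e, and the trace of the left action
   of b is phi_i(sum_j e y_j b x_j e) = phi_i(b). *)
From HB Require Import structures.
Require Import Defs.
From mathcomp Require Import all_boot all_order all_algebra.
From mathcomp Require Import boolp.

Set Implicit Arguments.
Unset Strict Implicit.
Unset Printing Implicit Defensive.

Import GRing.Theory.
Local Open Scope ring_scope.

(** * Dual bases: projectivity, and independence of the trace *)

Section DualBases.
Variables (R : pzRingType) (V : lmodType R).

(** The first components generate [V]; a map [g] is lifted through [f] by choosing preimages of the
    images of these generators and using the second components as coefficients. *)
Lemma fg_projective_dual_basis (d : seq (V * {linear V -> R^o})) :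
  dual_basis d -> fg_projective V.
Proof.
case: d => [d0|p0 d0].
  (* An empty dual basis forces [V] to be zero; it is treated apart because [nth] below takes a
     default entry from the list. *)
  have V0 (v : V) : v = 0 by rewrite (d0 v) big_nil.
  split; first by exists 0, (fun=> 0) => v; exists (fun=> 0); rewrite big_ord0.
  move=> X Y f g _; exists \0 => v.
  by rewrite (V0 v) !linear0.
set d := p0 :: d0 => dB; split.
  exists (size d), (fun i => (nth p0 d i).1) => v.
  by exists (fun i => (nth p0 d i).2 v); rewrite {1}(dB v) (big_nth p0) big_mkord.
move=> X Y f g f_surj; pose lift y := sval (cid (f_surj y)).
have liftK y : f (lift y) = y by rewrite /lift; case: cid.
pose h v := \sum_(p <- d) (p.2 v : R) *: lift (g p.1).
have h_lin : linear h.
  move=> c u v; rewrite /h scaler_sumr -big_split; apply: eq_bigr => p _ /=.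
  by rewrite linearP scalerDl scalerA.
pose H := GRing.isLinear.Build R V X _ h h_lin.
pose hL : {linear V -> X} := HB.pack h H.
exists hL => v; rewrite /= /h [in RHS](dB v) !linear_sum.
by apply: eq_bigr => p _; rewrite !linearZ /= liftK.
Qed.

(** The value of [slf_mod] does not depend on the dual basis chosen inside it. Expanding in both
    bases produces a double sum of products of two coefficients; symmetry of [psi] swaps the
    factors, and the sum over the other basis then collapses. *)
Lemma slf_mod_dual_basis (T : zmodType) (psi : R -> T)
    (d : seq (V * {linear V -> R^o})) (beta : {linear V -> V}) :
    zmod_morphism psi -> (forall a b, psi (a * b) = psi (b * a)) ->
  dual_basis d ->
  slf_mod psi beta = psi (\sum_(p <- d) (p.2 (beta p.1) : R)).
Proof.
move=> psiB psiC dB.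
have psi0 : psi 0 = 0 by rewrite -[X in psi X](subrr 0) psiB subrr.
have psiD : {morph psi : x y / x + y}.
  have psiN y : psi (- y) = - psi y by rewrite -[- y]sub0r psiB psi0 sub0r.
  by move=> x y /=; rewrite -[in LHS](opprK y) psiB psiN opprK.
have psi_sum := big_morph psi psiD psi0.
rewrite /slf_mod /a_dual_basis; case: pselect => [ex|[]]; last by exists d.
case: (cid ex) => d' /= d'B.
transitivity (psi (\sum_(p <- d') \sum_(q <- d)
    (q.2 (beta p.1) : R) * (p.2 q.1 : R))).
  congr psi; apply: eq_bigr => p _.
  (* Expand [beta p.1] in [d]; after the swap, [q.1] is recovered from its expansion in [d']. *)
  rewrite [in LHS](dB (beta p.1)) linear_sum.
  by apply: eq_bigr => q _; rewrite linearZ.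
transitivity (\sum_(q <- d) \sum_(p <- d')
    psi ((p.2 q.1 : R) * (q.2 (beta p.1) : R))).
  rewrite psi_sum exchange_big; apply: eq_bigr => p _; rewrite psi_sum.
  by apply: eq_bigr => q _; rewrite psiC.
rewrite psi_sum; apply: eq_bigr => q _.
rewrite [in RHS](d'B q.1) !linear_sum psi_sum.
by apply: eq_bigr => p _; rewrite !linearZ.
Qed.
End DualBases.

(** * Finite dimension passes to linear images *)

Section FiniteDimension.
Variable k : fieldType.

Definition lin_indep (V : lmodType k) m (v : 'I_m -> V) : Prop :=
  forall c : 'I_m -> k, \sum_i c i *: v i = 0 -> forall i, c i = 0.

Lemma lin_indep_bound n (V : lmodType k) (f : {linear V -> 'rV[k]_n}) m
    (v : 'I_m -> V) : injective f -> lin_indep v -> (m <= n)%N.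
Proof.
move=> f_inj vI; pose M := \matrix_(i < m) f (v i).
suff /eqP <- : row_free M by apply: rank_leq_col.
apply/inj_row_free => u uM0; apply/rowP => i; rewrite mxE.
apply: (vI (fun j => u 0 j)); apply: f_inj; rewrite linear0 linear_sum -[RHS]uM0.
by rewrite mulmx_sum_row; apply: eq_bigr => j _; rewrite linearZ rowK.
Qed.

(** Preimages of independent vectors are independent, so the dimension of [A] bounds the length of
    independent families in [B]. One of maximal length is a basis, and its coordinates give the
    required bijection. *)
Lemma finite_dimensional_surj (A B : pzAlgType k)
    (g : {linear kmod A -> kmod B}) :
  finite_dimensional A -> (forall b, exists a, g a = b) -> finite_dimensional B.
Proof.
move=> [n [f /bij_inj f_inj]] g_surj.
pose fam m := `[< exists v : 'I_m -> kmod B, lin_indep v >].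
have fam0 : exists m, fam m.
  by exists 0; apply/asboolP; exists (fun=> 0) => c _ [].
have fam_le m : fam m -> (m <= n)%N.
  move=> /asboolP[v vI]; pose lift b := sval (cid (g_surj b)).
  have liftK b : g (lift b) = b by rewrite /lift; case: cid.
  apply: (lin_indep_bound (v := fun i => lift (v i)) f_inj) => c c0.
  apply: vI; rewrite -[RHS](linear0 g) -c0 linear_sum.
  by apply: eq_bigr => i _; rewrite linearZ /= liftK.
have [m /asboolP[v vI] m_max] := ex_maxnP fam0 fam_le.
pose h (u : 'rV[k]_m) : kmod B := \sum_i u 0 i *: v i.
have h_lin : linear h.
  move=> c x y; rewrite /h scaler_sumr -big_split; apply: eq_bigr => i _ /=.
  by rewrite !mxE scalerDl scalerA.
pose H := GRing.isLinear.Build k 'rV[k]_m (kmod B) _ h h_lin.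
pose hL : {linear 'rV[k]_m -> kmod B} := HB.pack h H.
have h_inj : injective hL.
  apply: raddf_inj => u u0; apply/rowP => i.
  by rewrite mxE (vI (fun i => u 0 i)).
have h_surj b : exists u, hL u = b.
  (* A vector outside the span, put in front of [v], would give a longer independent family. *)
  apply: contrapT => b_out.
  suff /m_max : fam m.+1 by rewrite ltnn.
  apply/asboolP.
  exists (fun i => if unlift ord0 i is Some j then v j else b) => c.
  rewrite big_ord_recl unlift_none.
  under eq_bigr => i _ do rewrite liftK.
  move=> c_eq; have c0 : c ord0 = 0.
    apply/eqP; apply: contrapT => /negP c0; apply: b_out.
    (* If the coefficient of [b] were nonzero, solving the relation for [b] would put it in the
       span. *)
    exists (\row_i (- (c ord0)^-1 * c (lift ord0 i))).
    rewrite /= /h; under eq_bigr do rewrite mxE -scalerA.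
    rewrite -scaler_sumr -[\sum_i _](addKr (c ord0 *: b)) c_eq addr0.
    by rewrite scalerN scaleNr opprK scalerA mulVf ?scale1r.
  rewrite c0 scale0r add0r in c_eq.
  move=> i; case: (unliftP ord0 i) => [j ->|-> //].
  exact: (vI (fun j => c (lift ord0 j))).
pose s b := sval (cid (h_surj b)).
have sK : cancel s hL by move=> b; rewrite /s; case: cid.
have hK : cancel hL s by move=> u; apply: h_inj; rewrite sK.
have s_lin : linear s := can2_linear hK sK.
pose S := GRing.isLinear.Build k (kmod B) 'rV[k]_m _ s s_lin.
pose sL : {linear kmod B -> 'rV[k]_m} := HB.pack s S.
by exists m, sL; exists hL.
Qed.
End FiniteDimension.

(** * Module isomorphisms and right ideals of idempotents *)

Section ModIso.
Variable R : pzRingType.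

Lemma mod_iso_refl (U : lmodType R) : mod_iso U U.
Proof. by exists idfun; exists id. Qed.

Lemma mod_iso_sym (U V : lmodType R) : mod_iso U V -> mod_iso V U.
Proof.
move=> [f [g fK gK]].
have g_lin : linear g := can2_linear fK gK.
pose G := GRing.isLinear.Build R V U _ g g_lin.
pose gL : {linear V -> U} := HB.pack g G.
by exists gL; exists f.
Qed.

Lemma mod_iso_trans (U V W : lmodType R) :
  mod_iso U V -> mod_iso V W -> mod_iso U W.
Proof. by move=> [f f_bij] [g g_bij]; exists (g \o f); apply: bij_comp. Qed.
End ModIso.

(** With [a] the image of [e] and [b] the image of [f] under the inverse map, right linearity gives
    [e = b * a], and [b * f = b]. Scaling over the converse ring is right multiplication in [B]. *)
Lemma rideal_iso_factor (B : pzRingType) (e f : B) :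
    e * e = e -> f * f = f -> mod_iso (rideal e) (rideal f) ->
  exists x y : B, e = x * f * y.
Proof.
move=> ee ff [h [g hK gK]].
have eP : (e : (B^c)^o) \in in_rideal e by rewrite unfold_in; apply/eqP.
have fP : (f : (B^c)^o) \in in_rideal f by rewrite unfold_in; apply/eqP.
have g_lin : linear g := can2_linear hK gK.
pose G := GRing.isLinear.Build B^c (rideal f) (rideal e) _ g g_lin.
pose gL : {linear rideal f -> rideal e} := HB.pack g G.
pose eR : rideal e := RIdeal eP; pose fR : rideal f := RIdeal fP.
pose a : B := rideal_val (h eR); pose b : B := rideal_val (g fR).
have fa : f * a = a by rewrite /a; case: (h eR) => x /= /eqP.
have bf : b * f = b.
  have -> : b * f = rideal_val (gL ((f : B^c) *: fR)) by rewrite linearZ.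
  by congr (rideal_val (g _)); apply: val_inj; apply: ff.
have hE : h eR = (a : B^c) *: fR by apply: val_inj; rewrite /= -[LHS]fa.
exists b, a; rewrite bf.
have -> : e = rideal_val (gL (h eR)) by rewrite /= hK.
by rewrite hE linearZ.
Qed.

(** * Primitive decompositions and the existence of a full basic idempotent *)

Section OrthogonalIdempotents.
Variables (k : fieldType) (B : pzAlgType k).
Hypothesis finB : finite_dimensional B.

Definition orthogonal_decomposition m (t : 'I_m -> B) : Prop :=
  [/\ forall i, t i != 0, forall i, t i * t i = t i,
      forall i j, i != j -> t i * t j = 0 & \sum_i t i = 1].

Lemma orthogonal_lin_indep m (t : 'I_m -> B) :
  orthogonal_decomposition t -> lin_indep (t : 'I_m -> kmod B).
Proof.
move=> [t0 tt tort _] c sum0 i; apply/eqP; apply: contraT => ci.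
suff scti : scal (c i) * t i = 0.
  have := t0 i; rewrite -[t i]mul1r -(rmorph1 scal) -(mulVf ci) rmorphM.
  by rewrite -mulrA scti mulr0 eqxx.
have := congr1 (fun b : B => b * t i) sum0; rewrite mul0r => <-.
rewrite mulr_suml (bigD1 i) //= big1 ?addr0; last first.
  by move=> j ji; rewrite -mulrA tort ?mulr0.
by rewrite -mulrA tt.
Qed.

Lemma orthogonal_decomposition_exists :
  exists m (t : 'I_m -> B), orthogonal_decomposition t.
Proof.
(* In the zero algebra the unity is the empty sum, the only decomposition into nonzero terms. *)
have [B0|B0] := eqVneq (1 : B) 0.
  by exists 0, (fun=> 0); split=> [[] []|[] []|[] []|] //; rewrite big_ord0.
exists 1, (fun=> 1); split=> //.
- by move=> _; rewrite mulr1.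
- by move=> i j; rewrite !ord1.
- by rewrite big_ord1.
Qed.

(* Refining a decomposition increases its length, which is at most the
   dimension: a decomposition of maximal length is into primitives. *)
Lemma primitive_decomposition_exists :
  exists m (t : 'I_m -> B),
    orthogonal_decomposition t /\ forall i, primitive_idempotent (t i).
Proof.
have [n [f /bij_inj f_inj]] := finB.
pose len m := `[< exists t : 'I_m -> B, orthogonal_decomposition t >].
have len_ex : exists m, len m.
  have [m [t ?]] := orthogonal_decomposition_exists.
  by exists m; apply/asboolP; exists t.
have len_le m : len m -> (m <= n)%N.
  move=> /asboolP[t /orthogonal_lin_indep tI].
  exact: (lin_indep_bound f_inj tI).
have [m /asboolP[t tP] m_max] := ex_maxnP len_ex len_le.
have [t0 tt tort tsum] := tP.
exists m, t; split=> // i; split=> // g h gg hh gh hg tE.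
apply: contrapT => /not_orP[/eqP g0 /eqP h0].
suff /m_max : len m.+1 by rewrite ltnn.
(* Since [t i] fixes [g] and [h] on both sides, both are orthogonal to every other [t j]. *)
have tg : t i * g = g by rewrite tE mulrDl gg hg addr0.
have gt : g * t i = g by rewrite tE mulrDr gg gh addr0.
have th : t i * h = h by rewrite tE mulrDl hh gh add0r.
have ht : h * t i = h by rewrite tE mulrDr hh hg add0r.
(* The refinement replaces [t i] by [h] and puts [g] in front. *)
pose t' j := if j == i then h else t j.
have t'sum : \sum_j t' j = 1 - g.
  rewrite -tsum [in RHS](bigD1 i) //= [in LHS](bigD1 i) //= {1}/t' eqxx tE.
  rewrite [g + h]addrC addrAC addrK; congr (_ + _).
  by apply: eq_bigr => j /negPf ji; rewrite /t' ji.
have gt' j : g * t' j = 0.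
  rewrite /t'; case: eqP => [_|/eqP ji] //.
  by rewrite -gt -mulrA tort ?mulr0 // eq_sym.
have t'g j : t' j * g = 0.
  by rewrite /t'; case: eqP => [_|/eqP ji] //; rewrite -tg mulrA tort ?mul0r.
have t't' j l : j != l -> t' j * t' l = 0.
  rewrite /t' => jl; case: (eqVneq j i) jl => [->|ji] jl.
    by rewrite eq_sym (negPf jl) -ht -mulrA tort ?mulr0.
  case: eqVneq => [_|li]; last exact: tort.
  by rewrite -th mulrA tort ?mul0r.
apply/asboolP; exists (fun j => oapp t' g (unlift ord0 j)); split.
- move=> j; case: unliftP => [l _|_] //=.
  by rewrite /t'; case: (eqVneq l i).
- move=> j; case: unliftP => [l _|_] //=.
  by rewrite /t'; case: (eqVneq l i).
- move=> j l; case: unliftP => [j' ->|->]; case: unliftP => [l' ->|->] //=.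
  by rewrite (inj_eq lift_inj); apply: t't'.
- rewrite big_ord_recl unlift_none /=.
  under eq_bigr => j _ do rewrite liftK /=.
  by rewrite t'sum addrC subrK.
Qed.

(** Primitive idempotents are grouped by the isomorphism class of their right ideals, and [e] sums
    one representative per class. Every [t i] factors through its representative, hence through [e],
    so the unity lies in BeB. *)
Lemma basic_idempotent_exists :
  exists e : B, [/\ basic_idempotent e, e * e = e &
    exists (n : nat) (x y : 'I_n -> B), 1 = \sum_i x i * e * y i].
Proof.
have [m [t [[t0 tt tort tsum] tprim]]] := primitive_decomposition_exists.
pose R i j := `[< mod_iso (rideal (t i)) (rideal (t j)) >].
have R_equiv : {in [set: 'I_m] & &, equivalence_rel R}.
  move=> i j l _ _ _; split; first exact/asboolP/mod_iso_refl.
  move=> /asboolP ij; apply/asboolP/asboolP; apply: mod_iso_trans => //.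
  exact: mod_iso_sym.
pose P := equivalence_partition R [set: 'I_m].
have /and3P[/eqP coverP trivP P0] : partition P setT.
  exact: equivalence_partitionP.
pose blk (a : 'I_#|P|) : {set 'I_m} := enum_val a.
have blkP a : blk a \in P by apply: enum_valP.
(* Blocks of a partition are nonempty, so each size is a successor, the form that [basic_idempotent]
   asks for. *)
have blk_size a : (#|blk a|.-1).+1 = #|blk a|.
  rewrite prednK // card_gt0; apply: contraNneq P0 => <-; exact: blkP.
pose sz a := #|blk a|.-1.
(* [idx] sends a class and a position in it to the original index; its bijectivity lets sums over
   pairs be sums over ['I_m]. *)
pose idx (p : {a : 'I_#|P| & 'I_(sz a).+1}) : 'I_m :=
  enum_val (cast_ord (blk_size (tag p)) (tagged p)).
have idx_blk p : idx p \in blk (tag p) by apply: enum_valP.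
have idx_R p q : R (idx p) (idx q) <-> tag p = tag q.
  rewrite -(pblock_equivalence_partition R_equiv) ?in_setT // -/P.
  rewrite (def_pblock trivP (blkP _) (idx_blk p)).
  split=> [q_in|->]; last exact: idx_blk.
  apply: enum_val_inj; rewrite -/(blk _) -/(blk _).
  rewrite -(def_pblock trivP (blkP _) q_in).
  exact: def_pblock trivP (blkP _) (idx_blk q).
have idx_inj : injective idx.
  move=> p q pq; have tpq : tag p = tag q.
    by apply/idx_R; rewrite pq; apply/asboolP/mod_iso_refl.
  case: p q tpq pq => [a i] [b j] /= ab; case: b / ab j => j.
  by move/enum_val_inj/cast_ord_inj => /= ->.
have idx_surj i : exists p, idx p = i.
  have /bigcupP[b bP ib] : i \in cover P by rewrite coverP in_setT.
  pose a := enum_rank_in bP b.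
  have ba : blk a = b by rewrite /blk enum_rankK_in.
  rewrite -ba in ib; pose j := enum_rank_in ib i.
  exists (existT (fun a => 'I_(sz a).+1) a (cast_ord (esym (blk_size a)) j)).
  by rewrite /idx /= cast_ordKV enum_rankK_in.
have idx_bij : bijective idx.
  pose s i := sval (cid (idx_surj i)).
  have sK : cancel s idx by move=> i; rewrite /s; case: cid.
  by exists s => // p; apply: idx_inj; rewrite sK.
pose E p := t (idx p).
pose hd a := E (existT (fun a => 'I_(sz a).+1) a ord0).
pose e := \sum_a hd a.
have EE p q : p != q -> E p * E q = 0.
  by move=> pq; apply: tort; rewrite (inj_eq idx_inj).
have e_hd a : e * hd a = hd a.
  rewrite /e mulr_suml (bigD1 a) //= big1 ?addr0; first exact: tt.
  move=> b ba; apply: EE; apply: contraNneq ba.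
  by move=> /(congr1 tag) /= ->.
have hd_e a : hd a * e = hd a.
  rewrite /e mulr_sumr (bigD1 a) //= big1 ?addr0; first exact: tt.
  move=> b ba; apply: EE; apply: contraNneq ba.
  by move=> /(congr1 tag) /= ->.
exists e; split.
- exists #|P|, sz, E; split=> //.
  + by move=> p; apply: tprim.
  + by rewrite -tsum [RHS](reindex idx) //; apply: onW_bij.
  + by move=> p q; rewrite -idx_R; split=> /asboolP.
- by rewrite [in RHS]/e {2}/e mulr_sumr; apply: eq_bigr => a _; apply: e_hd.
(* The representative [hd] absorbs [e] on the right, so a factorization through [hd] is one through
   [e]. *)
have /choice[xy xyP] i : exists z : B * B, t i = z.1 * e * z.2.
  have [p <-] := idx_surj i; rewrite -/(E p).
  have [x [y ->]] : exists x y, E p = x * hd (tag p) * y.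
    apply: rideal_iso_factor; [exact: tt|exact: tt|].
    exact/asboolP/(idx_R p (existT _ (tag p) ord0)).
  by exists (x * hd (tag p), y); rewrite /= -[x * _ * e]mulrA hd_e.
exists m, (fun i => (xy i).1), (fun i => (xy i).2).
by rewrite -tsum; apply: eq_bigr => i _; rewrite xyP.
Qed.
End OrthogonalIdempotents.

(** * The quotient map as a ring morphism *)

Section ProjectionMorphism.
Variables (k : pzRingType) (B : pzAlgType k) (I : idealType B).

Fact qproj_monoid_morphism : monoid_morphism (@qproj k B I).
Proof. by split=> // a b; apply: qprojM. Qed.
HB.instance Definition _ := GRing.isZmodMorphism.Build B (algquot I)
  (@qproj k B I) (@qprojB k B I).
HB.instance Definition _ := GRing.isMonoidMorphism.Build B (algquot I)
  (@qproj k B I) qproj_monoid_morphism.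

Lemma qproj_eq0 (a : B) : (qproj I a == 0) = (a \in I).
Proof. by rewrite -(rmorph0 (@qproj k B I)) qproj_eq subr0. Qed.
End ProjectionMorphism.

(** * The bimodule Be over [A] and eBe, for a quotient B of [A] *)

Section LeftIdealBimodule.
Variables (k : fieldType) (A : pzAlgType k) (I : idealType A).
Variable e : idem (algquot I).
Local Notation B := (algquot I).

Definition in_lideal : {pred B} := fun x => x * idem_val e == x.

Fact lideal_zmod_closed : zmod_closed in_lideal.
Proof.
split=> [|x y]; first by rewrite unfold_in mul0r.
by rewrite !unfold_in mulrBl => /eqP-> /eqP->.
Qed.
HB.instance Definition _ := GRing.isZmodClosed.Build B in_lideal
  lideal_zmod_closed.

Record lideal := LIdeal { lideal_val : B; _ : lideal_val \in in_lideal }.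
HB.instance Definition _ := [isSub for lideal_val].
HB.instance Definition _ := [Choice of lideal by <:].
HB.instance Definition _ := [SubChoice_isSubZmodule of lideal by <:].

Lemma lideal_elr (m : lideal) : val m * idem_val e = val m.
Proof. by case: m => m /= /eqP. Qed.

Fact lideal_mulr_subproof (b : B) : b * idem_val e \in in_lideal.
Proof. by rewrite unfold_in -mulrA idemP. Qed.
Fact lideal_lact_subproof (a : A) (m : lideal) :
  qproj I a * val m \in in_lideal.
Proof. by rewrite unfold_in -mulrA lideal_elr. Qed.
Fact lideal_ract_subproof (m : lideal) (p : corner e) :
  val m * val p \in in_lideal.
Proof. by rewrite unfold_in -mulrA corner_elr. Qed.

Definition lideal_lact a m := LIdeal (lideal_lact_subproof a m).
Definition lideal_ract m p := LIdeal (lideal_ract_subproof m p).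

Definition lideal_bimodule : bimodule A (corner e).
Proof.
apply: (@Bimodule k A (corner e) lideal lideal_lact lideal_ract).
- by move=> a b m; apply: val_inj; rewrite /= rmorphM mulrA.
- by move=> m; apply: val_inj; apply: mul1r.
- by move=> a m n; apply: val_inj; apply: mulrDr.
- by move=> a b m; apply: val_inj; rewrite /= qprojD mulrDl.
- by move=> m p q; apply: val_inj; rewrite /= mulrA.
- by move=> m; apply: val_inj; apply: lideal_elr.
- by move=> m n p; apply: val_inj; apply: mulrDl.
- by move=> m p q; apply: val_inj; apply: mulrDr.
- by move=> a m p; apply: val_inj; rewrite /= mulrA.
- move=> c m; apply: val_inj => /=.
  (* A scalar [c] of the corner is [scal c * e], and [e] fixes [m] on the right. *)
  by rewrite [LHS](scalC c (val m)) mulrA -[in RHS]scalC -mulrA lideal_elr scalC.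
Defined.

Lemma lideal_factors : factors_through I lideal_bimodule.
Proof.
move=> a m aI; apply: val_inj => /=.
by have /eqP-> : qproj I a == 0; rewrite ?qproj_eq0 ?mul0r.
Qed.
End LeftIdealBimodule.

(** * The iterated trace on Be recovers [phi] *)

Section Trace.
Variables (k : fieldType) (A : pzAlgType k) (phi : slf A).
Local Notation B := (algquot (Rad phi)).

Lemma slf_quot_zmod_morphism : zmod_morphism (slf_quot (phi := phi)).
Proof.
move=> x y; rewrite -[x]qreprK -[y]qreprK -qprojB !slf_quotE.
exact: (linearB phi).
Qed.
HB.instance Definition _ := GRing.isZmodMorphism.Build B k
  (slf_quot (phi := phi)) slf_quot_zmod_morphism.

Lemma slf_quotC (x y : B) : slf_quot (x * y) = slf_quot (y * x).
Proof. by rewrite -[x]qreprK -[y]qreprK -!rmorphM !slf_quotE slfC. Qed.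

Lemma slf_quotZ (c : k) (x : B) : slf_quot (scal c * x) = c * slf_quot x.
Proof.
rewrite -[x]qreprK; have -> : scal c = qproj (Rad phi) (scal c) by [].
rewrite -rmorphM !slf_quotE; exact: (scalarZ (slf_val phi)).
Qed.

(** An element pairing to zero with everything lifts into [Rad phi], which the quotient kills. *)
Lemma slf_quot_nondegenerate (x : B) :
  (forall y, slf_quot (y * x) = 0) -> x = 0.
Proof.
rewrite -[x]qreprK => x0; apply/eqP; rewrite qproj_eq0; apply/asboolP => b.
by rewrite -slf_quotE rmorphM x0.
Qed.

Variable e : idem B.
Local Notation P := (corner e).
Local Notation M := (lideal_bimodule e).
Local Notation hM := (@lideal_factors k A (Rad phi) e).

Definition lideal_incl (m : lqmod hM) : B^o := val (m : lideal e).
Fact lideal_incl_linear : linear lideal_incl.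
Proof. by move=> x m n; rewrite /lideal_incl /= qreprK. Qed.
HB.instance Definition _ := GRing.isLinear.Build B (lqmod hM) B^o _
  lideal_incl lideal_incl_linear.

Fact lideal_idem_subproof : idem_val e \in in_lideal e.
Proof. by rewrite unfold_in idemP. Qed.

Definition lideal_dual_basis : seq (lqmod hM * {linear lqmod hM -> B^o}) :=
  [:: (LIdeal lideal_idem_subproof, lideal_incl : {linear _ -> _})].

Lemma lideal_dual_basisP : dual_basis lideal_dual_basis.
Proof.
move=> m; rewrite big_seq1; apply: val_inj => /=.
by rewrite qreprK lideal_elr.
Qed.

(** On the one-element dual basis, right multiplication by [p] has trace the value at [e * p], and
    [e * p = p] in the corner. *)
Lemma slf_left_lideal (p : P) : slf_left hM p = slf_quot (val p).
Proof.
rewrite /slf_left (slf_mod_dual_basis _ _ _ lideal_dual_basisP).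
- by rewrite big_seq1 /= /lideal_incl /= corner_ell.
- exact: slf_quot_zmod_morphism.
- exact: slf_quotC.
Qed.

Fact corner_coord_subproof (y : B) (m : lideal e) :
  idem_val e * y * val m \in in_corner e.
Proof. by rewrite unfold_in !mulrA idemP -mulrA lideal_elr. Qed.

Definition corner_coord (y : B) (m : rmod M) : (P^c)^o :=
  Corner (corner_coord_subproof y m).
Fact corner_coord_linear y : linear (corner_coord y).
Proof.
by move=> p m n; apply: val_inj; rewrite /= mulrDr !mulrA.
Qed.
HB.instance Definition _ y := GRing.isLinear.Build P^c (rmod M) (P^c)^o _
  (corner_coord y) (corner_coord_linear y).

Variables (n : nat) (x y : 'I_n -> B).
Hypothesis full : 1 = \sum_i x i * idem_val e * y i.

Definition corner_dual_basis : seq (rmod M * {linear rmod M -> (P^c)^o}) :=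
  [seq (LIdeal (lideal_mulr_subproof e (x i)) : rmod M,
        corner_coord (y i) : {linear _ -> _}) | i <- enum 'I_n].

(** Multiply [full] by [m] and split the middle [e] as [e * e]: one factor goes to the generator,
    the other to the coordinate. *)
Lemma corner_dual_basisP : dual_basis corner_dual_basis.
Proof.
move=> m; rewrite big_map big_enum; apply: val_inj.
rewrite (raddf_sum val) /= -[LHS]mul1r full mulr_suml.
by apply: eq_bigr => i _ /=; rewrite !mulrA -[x i * _ * _ in RHS]mulrA idemP.
Qed.

Lemma slf_left_right_lideal (b : A) : slf_left_right hM b = phi b.
Proof.
(* Independence of the dual basis is applied over the converse of the corner, so additivity and
   symmetry of the inner trace are checked there. *)
have leftB : zmod_morphism (slf_left hM : P^c -> k).
  by move=> p q; rewrite !slf_left_lideal -slf_quot_zmod_morphism.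
have leftC (p q : P^c) : slf_left hM (p * q) = slf_left hM (q * p).
  by rewrite !slf_left_lideal [LHS]slf_quotC.
rewrite /slf_left_right (slf_mod_dual_basis _ leftB leftC corner_dual_basisP).
rewrite slf_left_lideal big_map big_enum (raddf_sum val) /=.
rewrite -[in RHS](slf_quotE phi) -[in RHS](mulr1 (qproj _ b)) full mulr_sumr.
rewrite !raddf_sum; apply: eq_bigr => i _ /=.
(* Symmetry moves [e * y i] to the right end, where the two copies of [e] merge and rebuild the
   terms of [full]. *)
by rewrite [LHS]slf_quotC !mulrA -[_ * x i * _ * _ in LHS]mulrA idemP.
Qed.
End Trace.

(** * Finite dimension of quotients and corners *)

Section QuotientDimension.
Variables (k : fieldType) (A : pzAlgType k) (I : idealType A).

Definition qproj_linear (a : kmod A) : kmod (algquot I) :=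
  qproj I a.
Fact qproj_linear_linear : linear qproj_linear.
Proof. by move=> c a b; rewrite /qproj_linear rmorphD rmorphM. Qed.
HB.instance Definition _ := GRing.isLinear.Build k (kmod A)
  (kmod (algquot I)) _ qproj_linear qproj_linear_linear.

Lemma finite_dimensional_quot :
  finite_dimensional A -> finite_dimensional (algquot I).
Proof.
move=> finA; apply: (finite_dimensional_surj (g := qproj_linear)) => // x.
by exists (qrepr x); apply: qreprK.
Qed.
End QuotientDimension.

Section Compression.
Variables (k : fieldType) (B : pzAlgType k) (e : idem B).

Fact compress_subproof (b : B) : idem_val e * b * idem_val e \in in_corner e.
Proof. by rewrite unfold_in !mulrA idemP -mulrA idemP. Qed.
(** The Peirce projection; it is the identity on the corner, hence surjective. *)
Definition compress (b : kmod B) : kmod (corner e) :=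
  Corner (compress_subproof b).
Fact compress_linear : linear compress.
Proof.
move=> c a b; apply: val_inj; rewrite /= mulrDr mulrDl; congr (_ + _).
rewrite -[c *: a]/(scal c * (a : B)) !mulrA -[_ * scal c]scalC.
by rewrite -[scal c * _ * _ in RHS]mulrA idemP.
Qed.
HB.instance Definition _ := GRing.isLinear.Build k (kmod B) (kmod (corner e)) _
  compress compress_linear.

Lemma finite_dimensional_corner :
  finite_dimensional B -> finite_dimensional (corner e).
Proof.
move=> finB; apply: (finite_dimensional_surj (g := compress)) => // p.
by exists (val p); apply: val_inj; apply: corner_valP.
Qed.
End Compression.

(** * The symmetrizing form on the corner *)

Section CornerForm.
Variables (k : fieldType) (A : pzAlgType k) (phi : slf A).
Variable e : idem (algquot (Rad phi)).

Definition corner_form (p q : kmod (corner e)) : k :=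
  slf_quot (val (p : corner e) * val (q : corner e)).

Fact corner_form_bilinear : bilinear_for *%R *%R corner_form.
Proof.
split=> p c q r; rewrite /corner_form.
  rewrite mulrDl raddfD; congr (_ + _); apply: etrans (slf_quotZ _ _).
  by rewrite /= -!mulrA [idem_val e * (_ * _)]mulrA corner_ell.
rewrite mulrDr raddfD; congr (_ + _); apply: etrans (slf_quotZ _ _).
by rewrite /= -[scal c * _ * _]mulrA corner_ell !mulrA scalC.
Qed.
HB.instance Definition _ := bilinear_isBilinear.Build k (kmod (corner e))
  (kmod (corner e)) k *%R *%R corner_form corner_form_bilinear.

Lemma symmetric_algebra_corner :
  finite_dimensional A -> symmetric_algebra (corner e).
Proof.
move=> finA; split.
  exact/finite_dimensional_corner/finite_dimensional_quot.
exists (corner_form : {biscalar kmod (corner e)}); split=> [p q|p q r|p p0].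
- exact: slf_quotC.
- by rewrite /= /corner_form /= mulrA.
(* For [p] in the corner, pairing with [b] equals pairing with [compress e b], so nondegeneracy
   descends from the whole quotient. *)
- apply: val_inj; apply: slf_quot_nondegenerate => b.
  have := p0 (compress e b); rewrite /= /corner_form /= !mulrA corner_elr => pb0.
  by rewrite slf_quotC -pb0 [RHS]slf_quotC !mulrA corner_ell slf_quotC.
Qed.
End CornerForm.


(** * Central elements attached to a decomposition into ideals *)

Section DirectSum.
Variables (k : fieldType) (A : pzAlgType k) (l : nat) (I : 'I_l -> idealType A).
Hypothesis sumI : direct_sum (fun i => I i : {pred A}).

Lemma direct_sum_inj (x y : 'I_l -> A) :
    (forall i, x i \in I i) -> (forall i, y i \in I i) ->
  \sum_i x i = \sum_i y i -> x =1 y.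
Proof.
move=> xI yI xy i; have [z [_ z_uniq]] := sumI (\sum_i x i).
have zE w : (forall i, w i \in I i) -> \sum_i x i = \sum_i w i ->
    z = finfun w.
  move=> wI xw; apply: z_uniq; split=> [j|]; first by rewrite ffunE.
  by rewrite xw; apply: eq_bigr => j _; rewrite ffunE.
have /(congr1 (fun f : {ffun 'I_l -> A} => f i)) :=
  etrans (esym (zE x xI erefl)) (zE y yI xy).
by rewrite !ffunE.
Qed.

(** The [c i] are the components of the unity. Both [a * c i] and [c i * a] are the component of [a]
    in [I i], by uniqueness of components; this gives centrality, and vanishing when [a] lies in
    another summand. *)
Lemma direct_sum_central_idempotents :
  exists c : 'I_l -> A,
    [/\ \sum_i c i = 1, forall i a, a * c i = c i * a
      & forall i j a, j != i -> a \in I j -> a * c i = 0].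
Proof.
have [c [[cI c1] _]] := sumI 1.
exists c; split=> // [i a|i j a ji aI].
  apply: (@direct_sum_inj (fun i => a * c i) (fun i => c i * a)) => [m|m|].
  - exact: ideal_mull (cI m).
  - exact: ideal_mulr (cI m).
  - by rewrite -mulr_sumr -mulr_suml -c1 mulr1 mul1r.
have := @direct_sum_inj (fun m => a * c m) (fun m => if m == j then a else 0).
move=> /(_ _ _ _ i); rewrite eq_sym (negPf ji); apply=> [m|m|].
- exact: ideal_mull (cI m).
- by case: eqP => [->|_] //; apply: rpred0.
- by rewrite -mulr_sumr -c1 mulr1 -big_mkcond big_pred1_eq.
Qed.
End DirectSum.

(** * Cutting a symmetric function down to one summand *)

Section Cutoff.
Variables (k : fieldType) (A : pzAlgType k) (phi : slf A) (c : A).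

Definition slf_cut_val (a : kmod A) : k := phi (a * c).
Fact slf_cut_val_linear : scalar slf_cut_val.
Proof.
move=> d a b; rewrite /slf_cut_val mulrDl linearD; congr (_ + _).
by rewrite -mulrA; apply: (scalarZ (slf_val phi)).
Qed.
HB.instance Definition _ := GRing.isLinear.Build k (kmod A) k _ slf_cut_val
  slf_cut_val_linear.

Hypothesis cC : forall a, a * c = c * a.

Fact slf_cutC (a b : A) : slf_cut_val (a * b) = slf_cut_val (b * a).
Proof. by rewrite /slf_cut_val -mulrA slfC -mulrA -cC mulrA. Qed.

Definition slf_cut : slf A :=
  @Slf k A (slf_cut_val : {scalar kmod A}) slf_cutC.
End Cutoff.

Theorem theorem5p8 (k : closedFieldType) (char0 : [pchar k] =i pred0)
    (A : pzAlgType k) (finA : finite_dimensional A)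
    (phi : slf A) (nu : A) (nuC : forall a : A, nu * a = a * nu)
    (r : k) (s : nat) (s_gt0 : (0 < s)%N)
    (phi_nu : forall a : A, phi ((nu - scal r) ^+ s * a) = 0)
    (l : nat) (A_ : 'I_l -> idealType A)
    (A_sum : direct_sum (fun i => A_ i : {pred A})) :
  exists (phi_ : 'I_l -> slf A)
         (e : forall i, idem (algquot (Rad (phi_ i))))
         (M : forall i, bimodule A (corner (e i)))
         (hM : forall i, factors_through (Rad (phi_ i)) (M i)),
    [/\ forall i, extended_by_zero A_ i (phi_ i),
        forall i, basic_idempotent (idem_val (e i)) /\
                  symmetric_algebra (corner (e i)),
        forall i (m : M i), lact ((nu - scal r) ^+ s) m = 0,
        forall i, fg_projective (lqmod (hM i)) /\ fg_projective (rmod (M i))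
      & forall b : A, phi b = \sum_(i < l) slf_left_right (hM i) b].
Proof.
have [c [c1 cC cA]] := direct_sum_central_idempotents A_sum.
pose phi_ i := slf_cut phi (cC i).
(* The existence statement is turned into a sigma type, so that [e] can be chosen as a function of
   [i] while keeping its fullness. *)
have basicP i : {e : idem (algquot (Rad (phi_ i))) |
    basic_idempotent (idem_val e) /\
    exists n (x y : 'I_n -> algquot (Rad (phi_ i))),
      1 = \sum_j x j * idem_val e * y j}.
  apply: cid.
  have [e [eb ee efull]] :=
    basic_idempotent_exists (finite_dimensional_quot (Rad (phi_ i)) finA).
  by exists (Idem ee).
pose e i := sval (basicP i).
exists phi_, e, (fun i => lideal_bimodule (e i)).
exists (fun i => @lideal_factors _ _ _ (e i)).
split=> [i j ji a aI|i|i m|i|b].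
- by rewrite /= /slf_cut_val (cA i j) // linear0.
- by split; [exact: (svalP (basicP i)).1|exact: symmetric_algebra_corner].
(* The power of [nu - scal r] lies in the radical of [phi_ i]: symmetry brings it to the front,
   where [phi_nu] applies. *)
- apply: lideal_factors; rewrite unfold_in; apply/asboolP => b /=.
  by rewrite /slf_cut_val -mulrA slfC -mulrA phi_nu.
- split; first exact: fg_projective_dual_basis (@lideal_dual_basisP _ _ _ (e i)).
  have [_ [n [x [y full]]]] := svalP (basicP i).
  exact: fg_projective_dual_basis (corner_dual_basisP full).
(* Splitting the unity writes [phi b] as the sum of the [phi_ i b], each of which is an iterated
   trace. *)
- rewrite -[b in LHS]mulr1 -c1 mulr_sumr linear_sum; apply: eq_bigr => i _.
  have [_ [n [x [y full]]]] := svalP (basicP i).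
  by rewrite (slf_left_right_lideal full).
Qed.
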